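(* Let $\hat{\hat\omega}(\theta)$ denote the weak uniform Diophantine exponent of a real number $\theta$ (defined in the context). If $\theta\in\mathbb{Q}$, then $\hat{\hat\omega}(\theta)=\infty$. Moreover, $\{\hat{\hat\omega}(\theta)\,:\,\theta\in\mathbb{R}\setminus\mathbb{Q}\}=[1,2]$.
   Context: For $\theta\in\mathbb{R}$, the weak uniform Diophantine exponent $\hat{\hat\omega}(\theta)$ is the supremum of all real $\gamma$ such that for every sufficiently large real $t$ there exist integers $p,q$ with $1\le q\le t$ and $q|q\theta-p|\le t^{1-\gamma}$. *)

(* Defs.v *)
From HB Require Import structures.
From mathcomp Require Import all_boot all_order all_algebra.
From mathcomp Require Import all_classical all_reals all_analysis.

Set Implicit Arguments.
Unset Strict Implicit.
Unset Printing Implicit Defensive.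

Import Order.TTheory GRing.Theory Num.Theory.
Import numFieldNormedType.Exports.

Local Open Scope classical_set_scope.
Local Open Scope ring_scope.

Definition weak_admissible (R : realType) (theta gamma : R) : Prop :=
  \forall t \near +oo, exists p q : int,
    [/\ 1 <= q, (q%:~R : R) <= t &
        q%:~R * `|q%:~R * theta - p%:~R| <= t `^ (1 - gamma)].

(* The supremum is taken in the extended reals, so that it is [+oo] when
   arbitrarily large exponents are admissible. *)
Definition weak_uniform_exponent (R : realType) (theta : R) : \bar R :=
  ereal_sup [set gamma%:E | gamma in weak_admissible theta].

(* Main.v *)
Require Import Defs.
From HB Require Import structures.
From mathcomp Require Import all_boot all_order all_algebra.
From mathcomp Require Import all_classical all_reals all_analysis.
From mathcomp Require Import zify ring lra.

Set Implicit Arguments.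
Unset Strict Implicit.
Unset Printing Implicit Defensive.

Import Order.TTheory GRing.Theory Num.Theory.
Import numFieldNormedType.Exports.

Local Open Scope classical_set_scope.
Local Open Scope ring_scope.

(* Above 2 no exponent is admissible for an irrational number, by comparing
   approximations attached to consecutive integers.  To realise a given
   [gamma] in [1, 2], take [theta] to be the supremum of an increasing sequence
   of fractions [p n / q n] with [p n.+1 * q n - p n * q n.+1 = 1]; then
   [q n * theta - p n] is of order [1 / q n.+1], and for [b < q n.+1] the
   distance from [b * theta] to the integers is at least [1 / (2 * q n.+1)].
   Hence the minimum of [b * |b * theta - a|] over [q n <= b < q n.+1] is of
   order [q n / q n.+1].  If [q n] is of order [q n.+1 ^ c], evaluating at [t]
   just below [q n.+1] gives the exponent [2 - c].  For [gamma < 2] take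
   [c = 2 - gamma]; for [gamma = 2] let [q n.+1] be of order [q n ^ (n + 1)]. *)

(** * The exponent 1, and rational numbers *)

Lemma weak_admissible1 (R : realType) (theta : R) : weak_admissible theta 1.
Proof.
rewrite /weak_admissible subrr; near=> t.
exists (Num.floor theta), 1; split; first by [].
- by near: t; apply: nbhs_pinfty_ge.
- by rewrite powRr0 !mul1r ger0_norm ?subr_ge0 ?floor_le// lerBlDl ltW// -intrD1 floorD1_gt.
Unshelve. all: by end_near.
Qed.

Lemma weak_uniform_exponent_ge1 (R : realType) (theta : R) :
  (1%:E <= weak_uniform_exponent theta)%E.
Proof. by apply: ereal_sup_ubound; exists 1 => //; exact: weak_admissible1. Qed.

Lemma weak_admissible_rational (R : realType) (theta gamma : R) :
  rational theta -> weak_admissible theta gamma.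
Proof.
move=> [r _ <-]; rewrite /weak_admissible; near=> t.
exists (numq r), (denq r); split.
- by rewrite -gtz0_ge1 denq_gt0.
- by near: t; apply: nbhs_pinfty_ge.
- rewrite /ratr mulrC mulrCA mulfV ?intr_eq0 ?denq_eq0// mulr1 subrr normr0 mul0r.
  exact: powR_ge0.
Unshelve. all: by end_near.
Qed.

(** * The upper bound 2 for irrational numbers *)

Lemma norm_intr_lt1 (R : realType) (z : int) : `|z%:~R| < 1 :> R -> z = 0.
Proof. by rewrite -intr_norm ltrz1 => ?; lia. Qed.

Lemma powR_ge_near (R : realType) (d C : R) : 0 < d ->
  \forall t \near +oo, C <= t `^ d.
Proof.
move=> d0; near=> t; have [C0|C0] := lerP C 0; first exact: le_trans (powR_ge0 _ _).
have -> : C = (C `^ d^-1) `^ d by rewrite -powRrM mulVf ?gt_eqF// powRr1// ltW.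
have t0 : 0 < t by near: t; apply: nbhs_pinfty_gt.
have tC : C `^ d^-1 <= t by near: t; apply: nbhs_pinfty_ge.
by apply: ge0_ler_powR => //; rewrite ?nnegrE ?powR_ge0// ltW.
Unshelve. all: by end_near.
Qed.

(* If [gamma > 2], consecutive approximations [p_N / q_N] have determinant
   less than 1 in absolute value, so they are all equal from some point on. *)
Lemma weak_admissible_gt2 (R : realType) (theta gamma : R) :
  2 < gamma -> weak_admissible theta gamma -> rational theta.
Proof.
move=> g2 adm; apply: contrapT => irr.
have [A [_ HA]] : \forall t \near +oo, [/\ 1 <= t, 4 <= t `^ (gamma - 2) &
    exists p q : int, [/\ 1 <= q, (q%:~R : R) <= t &
        q%:~R * `|q%:~R * theta - p%:~R| <= t `^ (1 - gamma)]].
  near=> t; split; near: t; [exact: nbhs_pinfty_ge| |exact: adm].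
  by apply: powR_ge_near; rewrite subr_gt0.
pose N0 := (Num.truncn A).+1.
(* As [1 <= q], the distance is at most [N ^ (1 - gamma)], and [N ^ (gamma - 2) >= 4] turns this
   into [1 / (4 * N)]. *)
have good (N : nat) : (N0 <= N)%N -> exists p q : int,
    [/\ 1 <= q, q%:~R <= N%:R :> R & 4 * N%:R * `|q%:~R * theta - p%:~R| <= 1 :> R].
  move=> leN; have AN : A < N%:R by rewrite (lt_le_trans (truncnS_gt _))// ler_nat.
  have [N1 N4 [p [q [q1 qN pq]]]] := HA _ AN.
  exists p, q; split=> //.
  have q1R : 1 <= q%:~R :> R by rewrite ler1z.
  have N0' : 0 < N%:R :> R by lra.
  have eN : N%:R * N%:R `^ (1 - gamma) * N%:R `^ (gamma - 2) = 1 :> R.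
    rewrite -{1}(powRr1 (ltW N0')) -!powRD ?(gt_eqF N0') ?implybT//.
    by rewrite (_ : _ + _ = 0) ?powRr0//; ring.
  have x0 := normr_ge0 (q%:~R * theta - p%:~R).
  set x := `|_| in x0 pq *; set u := _ `^ _ in pq eN; set v := _ `^ _ in N4 eN.
  have u0 : 0 <= u by apply: powR_ge0.
  have xu : x <= u by nra.
  have Nu0 : 0 <= N%:R * u by rewrite mulr_ge0.
  have Nxu : N%:R * x <= N%:R * u by rewrite ler_pM2l.
  nra.
have [p0 [q0 [q01 q0N0 pq0]]] := good _ (leqnn N0).
have prop (k : nat) : exists p q : int,
    [/\ 1 <= q, q%:~R <= (N0 + k)%:R :> R,
        4 * (N0 + k)%:R * `|q%:~R * theta - p%:~R| <= 1 :> R & p * q0 = p0 * q].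
  elim: k => [|k [p [q [q1 qN pq e]]]].
    by rewrite addn0; exists p0, q0.
  rewrite addnS.
  have [p' [q' [q'1 q'N pq']]] := good (N0 + k).+1 (leqW (leq_addr _ _)).
  exists p', q'; split=> //.
  (* With [N = N0 + k], the two terms of the determinant are at most [N / (4 * (N + 1))] and
     [(N + 1) / (4 * N) <= 1 / 2], so their sum is below 1. *)
  have det0 : p * q' - p' * q = 0.
    apply: (@norm_intr_lt1 R).
    have -> : (p * q' - p' * q)%:~R = q%:~R * (q'%:~R * theta - p'%:~R)
        - q'%:~R * (q%:~R * theta - p%:~R) :> R by rewrite !(rmorphB, rmorphM)/=; ring.
    apply: le_lt_trans (ler_normB _ _) _; rewrite !normrM.
    rewrite [`|q%:~R|]ger0_norm ?ler0z; last lia.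
    rewrite [`|q'%:~R|]ger0_norm ?ler0z; last lia.
    have x0 := normr_ge0 (q%:~R * theta - p%:~R).
    have x'0 := normr_ge0 (q'%:~R * theta - p'%:~R).
    have Q1 : 1 <= q%:~R :> R by rewrite ler1z.
    have Q1' : 1 <= q'%:~R :> R by rewrite ler1z.
    move: qN q'N pq pq'; rewrite -[in (_ + k).+1%:R]natr1.
    set x := `|_| in x0 *; set x' := `|_| in x'0 *; set N := (N0 + k)%:R.
    move=> qN q'N pq pq'.
    have N1 : 1 <= N by lra.
    have h1 : 4 * (q%:~R * x') <= 1 by nra.
    have h2 : 4 * (q'%:~R * x) <= 2 by nra.
    lra.
  have q_neq0 : q != 0 by lia.
  apply: (mulIf q_neq0).
  have -> : p' * q0 * q = (p' * q) * q0 by ring.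
  have -> : p' * q = p * q' by lia.
  by rewrite mulrAC e; ring.
have d0 : 0 < `|q0%:~R * theta - p0%:~R|.
  rewrite normr_gt0 subr_eq0; apply/negP => /eqP e; apply: irr.
  apply/rationalP; exists p0, `|q0|%N.
  rewrite -e natr_absz ger0_norm; last lia.
  by rewrite mulrAC mulfV ?mul1r// intr_eq0; lia.
set d := `|_| in d0.
(* Proportionality to [(p0, q0)] forces [d <= q0 * |q * theta - p|], which is at most
   [q0 / (4 * k)]; this fails once [k > q0 / d]. *)
have [p [q [q1 qN pq e]]] := prop (Num.truncn (q0%:~R / d)).+1.
have kd : q0%:~R < (Num.truncn (q0%:~R / d)).+1%:R * d by rewrite -ltr_pdivrMr ?truncnS_gt.
have eqd : q0%:~R * `|q%:~R * theta - p%:~R| = q%:~R * d.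
  rewrite -[q0%:~R in LHS]ger0_norm ?ler0z; last lia.
  rewrite -[q%:~R in RHS]ger0_norm ?ler0z; last lia.
  rewrite -!normrM !mulrBr -!rmorphM/= [q0 * p]mulrC e [q * p0]mulrC.
  by congr (`|_ - _|); ring.
have Q1 : 1 <= q%:~R :> R by rewrite ler1z.
have Q01 : 1 <= q0%:~R :> R by rewrite ler1z.
move: pq eqd kd; rewrite natrD; set x := `|_| => pq eqd kd.
have x0 : 0 <= x := normr_ge0 _.
have := ler0n R N0.
set k := (Num.truncn _).+1%:R in pq kd * => N00.
have k0 : 0 < k by rewrite ltr0n.
have h1 : d <= q0%:~R * x by rewrite eqd ler_peMl// ltW.
have h2 : 4 * k * x <= 1 by nra.
have h3 : k * d <= q0%:~R * (k * x) by nra.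
nra.
Unshelve. all: by end_near.
Qed.

(** * Limits of unimodular sequences of fractions *)

Section UnimodularSequence.
Variables (R : realType) (p q : nat -> int).
Hypothesis det1 : forall n, p n.+1 * q n - p n * q n.+1 = 1.
Hypothesis q0E : q 0%N = 1.
Hypothesis q_growth : forall n, 4 * q n <= q n.+1.

Local Notation Q n := ((q n)%:~R : R).
Local Notation P n := ((p n)%:~R : R).

Lemma denominator_ge1 n : 1 <= q n.
Proof. by elim: n => [|n IHn]; [rewrite q0E | have := q_growth n; lia]. Qed.

Lemma denominator_ge n : n%:Z < q n.
Proof.
elim: n => [|n IHn]; first by rewrite q0E.
have := q_growth n; have := denominator_ge1 n; lia.
Qed.

Lemma denominator_homo : {homo q : m n / (m <= n)%N >-> m <= n}.
Proof.
apply: homo_leq => //; first exact: le_trans.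
by move=> n; have := q_growth n; have := denominator_ge1 n; lia.
Qed.

Lemma denominator_bracket (x : R) : 1 <= x -> exists n, Q n <= x < Q n.+1.
Proof.
move=> x1.
have ex : exists n, x < Q n.
  exists (Num.truncn x).+1; apply: lt_trans (truncnS_gt x) _.
  by rewrite pmulrn ltr_int denominator_ge.
case: (ex_minnP ex) => -[|n xQ min].
  by rewrite q0E mulr1z ltNge x1.
exists n; rewrite xQ andbT leNgt; apply/negP => /min.
by rewrite ltnn.
Qed.

(** The intervals from [f n = p n / q n] to [g n = f n + 2 / (q n * q n.+1)] are nested, so
    [theta = sup f] lies in all of them. The upper bound is [theta <= g n]; the lower one is
    [f n.+1 <= theta]. *)
Lemma unimodular_limit : exists theta : R,
  forall n, (Q n.+1)^-1 <= Q n * theta - P n <= 2 / Q n.+1.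
Proof.
have Q0 n : 0 < Q n by rewrite ltr0z; have := denominator_ge1 n; lia.
have Qg n : 4 * Q n <= Q n.+1.
  by rewrite (_ : 4 = 4%:~R)// -intrM ler_int q_growth.
pose f n := P n / Q n; pose g n := f n + 2 / (Q n * Q n.+1).
have fS n : f n.+1 = f n + (Q n * Q n.+1)^-1.
  have detR : P n.+1 * Q n - P n * Q n.+1 = 1.
    by rewrite -!intrM -intrB det1.
  have -> : (Q n * Q n.+1)^-1 = (P n.+1 * Q n - P n * Q n.+1) / (Q n * Q n.+1).
    by rewrite detR mul1r.
  rewrite /f.
  by field; rewrite !(gt_eqF (Q0 _)).
have f_homo : {homo f : m n / (m <= n)%N >-> m <= n}.
  apply: homo_leq => //; first exact: le_trans.
  by move=> n; rewrite fS lerDl invr_ge0 mulr_ge0// ltW.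
have g_homo : {homo g : m n / (m <= n)%N >-> n <= m}.
  apply: homo_leq => //; first by move=> x y z xy yz; exact: le_trans yz xy.
  move=> n; rewrite /g fS -addrA lerD2l.
  have -> : 2 / (Q n * Q n.+1) = (Q n * Q n.+1)^-1 + (Q n * Q n.+1)^-1 by ring.
  rewrite lerD2l ler_pdivrMr ?mulr_gt0// mulrC ler_pdivlMr ?mulr_gt0//.
  have := Qg n; have := Qg n.+1; have := Q0 n; have := Q0 n.+1.
  by move=> *; nra.
have fg m n : f m <= g n.
  apply: le_trans (f_homo _ _ (leq_maxl m n)) _.
  apply: le_trans (g_homo _ _ (leq_maxr m n)).
  by rewrite lerDl divr_ge0// mulr_ge0// ltW.
pose theta := sup (range f); exists theta => n.
have f_le m : f m <= theta.
  by apply: ub_le_sup; [exists (g 0%N) => _ [k _ <-]|exists m].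
have le_g : theta <= g n.
  by apply: ge_sup; [exists (f 0%N), 0%N|move=> _ [k _ <-]].
have -> : Q n * theta - P n = Q n * (theta - f n).
  by rewrite mulrBr /f [_ * (P n / _)]mulrCA mulfV ?mulr1// gt_eqF.
have -> : (Q n.+1)^-1 = Q n * (Q n * Q n.+1)^-1 by field; rewrite !(gt_eqF (Q0 _)).
rewrite mulrCA !ler_pM2l// -lerBlDl.
have := f_le n.+1; rewrite fS => h.
by apply/andP; split; rewrite ?lerBlDl ?lerBrDl.
Qed.

Variable theta : R.
Hypothesis thetaP : forall n, (Q n.+1)^-1 <= Q n * theta - P n <= 2 / Q n.+1.

(* If [a / b] were equal to [p n.+1 / q n.+1], its denominator would be at
   least [q n.+1], because [p n.+1] and [q n.+1] are coprime. *)
Lemma approximation_gap n (a b : int) : 1 <= b < q n.+1 ->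
  (2 * Q n.+1)^-1 <= `|b%:~R * theta - a%:~R|.
Proof.
move=> /andP[b1 bq].
have det_neq0 : a * q n.+1 - b * p n.+1 != 0.
  apply/eqP => e.
  have eb : b = q n.+1 * (a * q n - p n * b).
    rewrite -[LHS]mulr1 -(det1 n).
    have -> : b * (p n.+1 * q n - p n * q n.+1) =
              (b * p n.+1) * q n - b * p n * q n.+1 by ring.
    have -> : b * p n.+1 = a * q n.+1 by apply/esym/subr0_eq.
    ring.
  set k := a * q n - _ in eb.
  have := denominator_ge1 n.+1; clearbody k; move: (q n.+1) bq eb => d bq eb d1.
  have [k0|k0] := lerP k 0; nia.
have det_ge1 : 1 <= `|(a * q n.+1 - b * p n.+1)%:~R| :> R.
  by rewrite -intr_norm ler1z; lia.
have detE : (a * q n.+1 - b * p n.+1)%:~R =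
   b%:~R * (Q n.+1 * theta - P n.+1) - Q n.+1 * (b%:~R * theta - a%:~R).
  by rewrite !(rmorphB, rmorphM)/=; ring.
have Q0 m : 0 < Q m by rewrite ltr0z; have := denominator_ge1 m; lia.
have Qg : 4 * Q n.+1 <= Q n.+2.
  by rewrite (_ : 4 = 4%:~R)// -intrM ler_int q_growth.
have /andP[lo hi] := thetaP n.+1.
have bQ : b%:~R < Q n.+1 by rewrite ltr_int.
have b1R : 1 <= b%:~R :> R by rewrite ler1z.
have y0 : 0 <= Q n.+1 * theta - P n.+1 by apply: le_trans lo; rewrite invr_ge0 ltW.
have := ler_normB (b%:~R * (Q n.+1 * theta - P n.+1)) (Q n.+1 * (b%:~R * theta - a%:~R)).
rewrite -detE => /(le_trans det_ge1).
rewrite !normrM [`|_ - P _|]ger0_norm// [`|b%:~R|]ger0_norm; last lra.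
rewrite [`|Q _|]ger0_norm ?(ltW (Q0 _))//.
(* The growth factor 4 serves here: this term takes at most half of a determinant of absolute value
   at least 1, and the other half bounds [Q n.+1 * |b * theta - a|] from below. *)
have small : b%:~R * (Q n.+1 * theta - P n.+1) <= 2^-1.
  apply: (@le_trans _ _ (Q n.+1 * (2 / Q n.+2))).
    by apply: ler_pM => //; [lra|exact: ltW].
  rewrite mulrA ler_pdivrMr//; lra.
set x := `|_ - a%:~R|; move=> big.
by rewrite invfM mulrC ler_pdivrMl//; lra.
Qed.

(** For rational [theta], its own denominator would give distance 0, against [approximation_gap]. *)
Lemma unimodular_limit_irrational : irrational theta.
Proof.
move=> [r _ rE].
have ge1 : (1 : R) <= (denq r)%:~R by rewrite ler1z -gtz0_ge1 denq_gt0.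
have [n /andP[_ rn]] := denominator_bracket ge1.
have := @approximation_gap n (numq r) (denq r).
rewrite -gtz0_ge1 denq_gt0/= => /(_ _).
rewrite -(ltr_int R) => /(_ rn).
rewrite -rE /ratr [_ * (_ / _)]mulrC divfK ?intr_eq0 ?denq_eq0// subrr normr0 leNgt.
by rewrite invr_gt0 mulr_gt0// ltr0z; have := denominator_ge1 n.+1; lia.
Qed.

(** For [q n <= t < q n.+1] the pair [(p n, q n)] works: its product is at most
    [2 * Q n.+1 ^ (c - 1)]. The gap between [gamma] and [2 - c] absorbs the 2, and since
    [gamma >= 1], replacing [t] by [Q n.+1] only lowers the right-hand side. *)
Lemma unimodular_admissible (c gamma : R) : 1 <= gamma -> gamma < 2 - c ->
  (\forall n \near \oo, Q n <= Q n.+1 `^ c) -> weak_admissible theta gamma.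
Proof.
move=> g1 gc [N _ Nc].
have d0 : 0 < 2 - c - gamma by rewrite subr_gt0.
rewrite /weak_admissible; near=> t.
have t1 : 1 <= t by near: t; apply: nbhs_pinfty_ge.
have tN : Q N <= t by near: t; apply: nbhs_pinfty_ge; rewrite num_real.
have t2 : 2 <= t `^ (2 - c - gamma) by near: t; apply: powR_ge_near.
have [n /andP[Qn Qn1]] := denominator_bracket t1.
have leNn : (N <= n)%N.
  rewrite leqNgt; apply/negP => /denominator_homo.
  by rewrite -(ler_int R) => /(lt_le_trans Qn1); rewrite ltNge tN.
exists (p n), (q n); split=> //; first exact: denominator_ge1.
have Q0 m : 0 < Q m by rewrite ltr0z; have := denominator_ge1 m; lia.
have /andP[lo hi] := thetaP n.
rewrite ger0_norm; last by apply: le_trans lo; rewrite invr_ge0 ltW.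
have t_le_Q : t <= Q n.+1 := ltW Qn1.
have Q2 : 2 <= Q n.+1 `^ (2 - c - gamma).
  by apply: le_trans t2 _; apply: ge0_ler_powR; rewrite ?nnegrE; lra.
apply: (@le_trans _ _ (Q n.+1 `^ (1 - gamma))); last first.
  rewrite -(opprB gamma 1) !powRN lef_pV2 ?posrE ?powR_gt0//.
  by apply: ge0_ler_powR; rewrite ?nnegrE; lra.
have -> : Q n.+1 `^ (1 - gamma) =
    Q n.+1 `^ c * (Q n.+1 `^ (2 - c - gamma) / Q n.+1).
  rewrite -{4}[Q n.+1]powRr1 ?(ltW (Q0 _))// -powRB ?(gt_eqF (Q0 _)) ?implybT//.
  by rewrite -powRD ?(gt_eqF (Q0 _)) ?implybT//; congr (_ `^ _); ring.
apply: ler_pM.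
- exact: ltW (Q0 n).
- by apply: le_trans lo; rewrite invr_ge0 ltW.
- exact: Nc.
- by apply: le_trans hi _; rewrite ler_wpM2r// invr_ge0 ltW.
Unshelve. all: by end_near.
Qed.

(** Take [t = Q n.+1 / 2], so that every [b <= t] lies in a bracket [q k <= b < q k.+1] with
    [k <= n]. The gap bounds the product below by [Q k.+1 ^ (c - 1) / 12], which is smallest at
    [k = n] because [c <= 1]. *)
Lemma unimodular_not_admissible (c gamma : R) :
  0 < c <= 1 -> 2 - c < gamma ->
  (forall n, Q n.+1 `^ c <= 6 * Q n) -> ~ weak_admissible theta gamma.
Proof.
move=> /andP[c0 c1] gc Qc adm.
have d0 : 0 < gamma - (2 - c) by rewrite subr_gt0.
(* The constant 25 beats [12 * 2]: 12 is the 6 of the growth hypothesis times the 2 of the gap, and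
   the last 2 bounds [2 ^ (1 - c)], the cost of halving [Q n.+1]. *)
have [A [_ HA]] : \forall t \near +oo, [/\ 1 <= t, 25 <= t `^ (gamma - (2 - c)) &
    exists a b : int, [/\ 1 <= b, (b%:~R : R) <= t &
        b%:~R * `|b%:~R * theta - a%:~R| <= t `^ (1 - gamma)]].
  near=> t; split; near: t; [exact: nbhs_pinfty_ge| |exact: adm].
  exact: powR_ge_near.
have Q0 m : 0 < Q m by rewrite ltr0z; have := denominator_ge1 m; lia.
pose n := Num.truncn (2 * A).
have An : A < Q n.+1 / 2.
  rewrite ltr_pdivlMr// mulrC (lt_trans (truncnS_gt _))//.
  by rewrite pmulrn ltr_int denominator_ge.
have [t1 t25 [a [b [b1 bt bx]]]] := HA _ An.
have b1R : 1 <= b%:~R :> R by rewrite ler1z.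
have [k /andP[Qkb bQk]] := denominator_bracket b1R.
have lekn : (k <= n)%N.
  rewrite leqNgt; apply/negP => /denominator_homo; rewrite -(ler_int R) => nk.
  have : Q n.+1 <= Q k := nk; have := Q0 n.+1; lra.
have gap : (2 * Q k.+1)^-1 <= `|b%:~R * theta - a%:~R|.
  by apply: approximation_gap; rewrite b1 -(ltr_int R).
have lb : Q n.+1 `^ (c - 1) <= 12 * (b%:~R * `|b%:~R * theta - a%:~R|).
  apply: (@le_trans _ _ (Q k.+1 `^ (c - 1))).
    rewrite -(opprB 1 c) !powRN lef_pV2 ?posrE ?powR_gt0//.
    apply: ge0_ler_powR; rewrite ?nnegrE ?subr_ge0 ?(ltW (Q0 _))//.
    by rewrite ler_int denominator_homo.
  rewrite powRB ?(gt_eqF (Q0 _)) ?implybT// powRr1 ?(ltW (Q0 _))// ler_pdivrMr//.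
  apply: le_trans (Qc k) _.
  have h : b%:~R * (2 * Q k.+1)^-1 <= b%:~R * `|b%:~R * theta - a%:~R|.
    by rewrite ler_wpM2l//; lra.
  rewrite -mulrA (mulrC _ (Q k.+1)).
  have : Q k.+1 * (b%:~R * (2 * Q k.+1)^-1) <=
         Q k.+1 * (b%:~R * `|b%:~R * theta - a%:~R|) by rewrite ler_pM2l.
  have -> : Q k.+1 * (b%:~R * (2 * Q k.+1)^-1) = b%:~R / 2.
    by field; rewrite (gt_eqF (Q0 _)).
  lra.
have : (Q n.+1 / 2) `^ (1 - gamma) * (Q n.+1 / 2) `^ (gamma - (2 - c)) <=
   2 * Q n.+1 `^ (c - 1).
  rewrite -powRD; last by apply/implyP => _; rewrite gt_eqF// divr_gt0.
  have -> : 1 - gamma + (gamma - (2 - c)) = c - 1 by ring.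
  rewrite powRM ?invr_ge0 ?(ltW (Q0 _))// [leLHS]mulrC ler_wpM2r ?powR_ge0//.
  rewrite -[2^-1]powR_inv1// -powRrM.
  by rewrite -[leRHS]powRr1// ler_powR//; lra.
have := powR_gt0 (1 - gamma) (divr_gt0 (Q0 n.+1) (ltr0Sn R 1)).
set u := _ `^ (1 - gamma) in bx *; set v := _ `^ (gamma - _) in t25 *.
set w := _ `^ (c - 1) in lb *; move=> u0 uv.
have : 25 * u <= u * v by rewrite mulrC ler_pM2l.
lra.
Unshelve. all: by end_near.
Qed.

End UnimodularSequence.

(** * Sequences with prescribed growth *)

(** This is a continued fraction with minus signs: the recursion [x n.+1 = a * x n - x n.-1] keeps
    the determinant equal to 1, and [a >= 2] keeps the denominators nondecreasing. The coefficient
    may depend on the current denominator, so growth can be prescribed as a function of it. *)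
Lemma unimodular_sequence (a : nat -> int -> int) :
  (forall n x, 2 <= a n x) ->
  exists p q : nat -> int,
    [/\ forall n, p n.+1 * q n - p n * q n.+1 = 1, q 0%N = 1 &
        forall n, (a n (q n) - 1) * q n <= q n.+1 <= a n (q n) * q n].
Proof.
move=> a2.
pose next n (s : (int * int) * (int * int)) :=
  (s.2, (a n s.2.2 * s.2.1 - s.1.1, a n s.2.2 * s.2.2 - s.1.2)).
(* The seed [(-1, 0)] plays the role of the pair of index [-1]. *)
pose s := fix s n := if n is m.+1 then next m (s m) else ((-1, 0), (0, 1)).
have sS n : s n.+1 = next n (s n) by [].
have inv n : [/\ (s n).2.1 * (s n).1.2 - (s n).1.1 * (s n).2.2 = 1,
                 0 <= (s n).1.2 & (s n).1.2 <= (s n).2.2].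
  elim: n => [//|n [det0 r0 rq]]; rewrite sS /next /=; split.
  - by rewrite -det0; ring.
  - exact: le_trans rq.
  - have := a2 n (s n).2.2; move: rq r0.
    move: (s n).1.2 (s n).2.2 (a n _) => r x y *; nia.
exists (fun n => (s n).2.1), (fun n => (s n).2.2); split=> // n; rewrite sS /next /=;
  have [det0 r0 rq] := inv n.
- by rewrite -det0; ring.
- by rewrite mulrBl mul1r lerB ?lexx//= gerDl oppr_le0 r0.
Qed.

Lemma power_growth_sequence (R : realType) (s : nat -> R) :
  (forall n, 0 <= s n) ->
  exists p q : nat -> int,
    [/\ forall n, p n.+1 * q n - p n * q n.+1 = 1, q 0%N = 1,
        forall n, 4 * q n <= q n.+1 &
        forall n, (q n)%:~R `^ (1 + s n) <= (q n.+1)%:~R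
                    <= 6 * (q n)%:~R `^ (1 + s n)].
Proof.
move=> s0.
(* The summand 5 makes each denominator at least 4 times the previous one. *)
pose a n (x : int) := (Num.truncn ((x%:~R : R) `^ s n))%:Z + 5.
have [|p [q [det1 q0 qa]]] := @unimodular_sequence a.
  by move=> n x; rewrite /a; lia.
have q1 n : 1 <= q n.
  elim: n => [|n IHn]; first by rewrite q0.
  by have := qa n; rewrite /a; nia.
exists p, q; split=> // n; have /andP[lo hi] := qa n; have := q1 n.
  by move: lo; rewrite /a; nia.
move=> qn1; have Q1 : 1 <= (q n)%:~R :> R by rewrite ler1z.
have Q0 : 0 < (q n)%:~R :> R by rewrite (lt_le_trans ltr01).
rewrite powRD ?(gt_eqF Q0) ?implybT// powRr1 ?(ltW Q0)//.
move: lo hi; rewrite -!(ler_int R) !(rmorphB, rmorphM)/= /a rmorphD/=.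
have /andP[] := truncn_itv (powR_ge0 (q n)%:~R (s n)).
(* With [u = q n ^ s n >= 1], the coefficient is at most [u + 5 <= 6 * u], hence the constant 6. *)
have : 1 <= (q n)%:~R `^ s n :> R by rewrite -[leLHS](powRr0 (q n)%:~R) ler_powR.
rewrite -pmulrn -[(_.+1)%:R]natr1.
set u := _ `^ _; set k := (Num.truncn u)%:R => u1 ku uk lo hi.
by apply/andP; split; nra.
Qed.

(** * Realising every exponent in [1, 2] *)

Lemma weak_uniform_exponentE (R : realType) (theta gamma : R) : 1 <= gamma ->
  (forall g, 1 <= g < gamma -> weak_admissible theta g) ->
  (forall g, gamma < g -> ~ weak_admissible theta g) ->
  weak_uniform_exponent theta = gamma%:E.
Proof.
move=> g1 lo hi; apply/le_anti/andP; split.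
  apply: ge_ereal_sup => _ [g adm <-]; rewrite lee_fin leNgt.
  by apply/negP => /hi.
rewrite leNgt; apply/negP.
have := weak_uniform_exponent_ge1 theta.
have ub g : weak_admissible theta g -> (g%:E <= weak_uniform_exponent theta)%E.
  by move=> adm; apply: ereal_sup_ubound; exists g.
move: (weak_uniform_exponent theta) ub => [r| |]// ub.
rewrite lee_fin lte_fin => r1 rg.
(* If the supremum [r] were below [gamma], the midpoint would be an admissible exponent above [r];
   it is at least 1 because [r] is. *)
have := ub ((r + gamma) / 2) (lo _ _); rewrite lee_fin => h.
have : (r + gamma) / 2 <= r by apply: h; lra.
lra.
Qed.

Lemma weak_uniform_exponent_surj (R : realType) (gamma : R) : 1 <= gamma <= 2 ->
  exists2 theta : R, irrational theta & weak_uniform_exponent theta = gamma%:E.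
Proof.
move=> /andP[g1]; rewrite le_eqVlt => /predU1P[->|g2].
  have [p [q [det1 q0 q4 qs]]] := @power_growth_sequence R (fun n => n%:R) (fun n => ler0n _ n).
  have [theta thetaP] := unimodular_limit R det1 q0 q4.
  have irr := unimodular_limit_irrational det1 q0 q4 thetaP.
  exists theta => //; apply: weak_uniform_exponentE => [|g /andP[gge1 glt2]|g gt2].
  - lra.
  - have c0 : 0 < (2 - g) / 2 by lra.
    apply: (@unimodular_admissible _ _ _ q0 q4 _ thetaP ((2 - g) / 2) _ gge1); first lra.
    (* With [c = (2 - g) / 2], beyond this index [(1 + n) * c >= 1], so
       [q n <= (q n ^ (1 + n)) ^ c <= q n.+1 ^ c]. *)
    exists (Num.truncn ((2 - g) / 2)^-1) => // n /= leNn.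
    have Q1 m : 1 <= (q m)%:~R :> R by rewrite ler1z (denominator_ge1 q0 q4).
    have /andP[lo _] := qs n.
    apply: (@le_trans _ _ (((q n)%:~R `^ (1 + n%:R)) `^ ((2 - g) / 2))); last first.
      apply: ge0_ler_powR lo; rewrite ?nnegrE ?powR_ge0//; first exact: ltW.
      by apply: le_trans (Q1 _).
    rewrite -powRrM -{1}[(q n)%:~R]powRr1; last by apply: le_trans (Q1 _).
    apply: ler_powR => //; rewrite -ler_pdivrMr// mul1r [1 + _]addrC natr1 ltW//.
    by apply: lt_le_trans (truncnS_gt _) _; rewrite ler_nat.
  - by move=> /(weak_admissible_gt2 gt2).
pose c := 2 - gamma.
have c0 : 0 < c by rewrite subr_gt0.
have c1 : c <= 1 by rewrite /c; lra.
(* The choice [s = 1 / c - 1] makes [q n.+1] of order [q n ^ (1 / c)]. *)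
have s0 : 0 <= c^-1 - 1 by rewrite subr_ge0 invf_ge1.
have [p [q [det1 q0 q4 qs]]] := @power_growth_sequence R (fun=> c^-1 - 1) (fun=> s0).
have [theta thetaP] := unimodular_limit R det1 q0 q4.
have Q1 m : 1 <= (q m)%:~R :> R by rewrite ler1z (denominator_ge1 q0 q4).
have Q0 m : 0 <= (q m)%:~R :> R := le_trans ler01 (Q1 m).
have qs' n : (q n)%:~R `^ c^-1 <= (q n.+1)%:~R <= 6 * (q n)%:~R `^ c^-1.
  by have := qs n; rewrite subrKC.
have QcK n : ((q n)%:~R `^ c^-1) `^ c = (q n)%:~R :> R.
  by rewrite -powRrM mulVf ?gt_eqF// powRr1.
have irr := unimodular_limit_irrational det1 q0 q4 thetaP.
exists theta => //.
apply: weak_uniform_exponentE => // [g /andP[gge1 gg]|g gg].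
  apply: (@unimodular_admissible _ _ _ q0 q4 _ thetaP c _ gge1).
    by rewrite /c; lra.
  exists 0%N => // n _; have /andP[lo _] := qs' n.
  rewrite -{1}QcK.
  by apply: ge0_ler_powR lo; rewrite ?nnegrE ?powR_ge0// ltW.
apply: (@unimodular_not_admissible _ _ _ det1 q0 q4 _ thetaP c).
- by rewrite c0.
- by rewrite /c; lra.
- move=> n; have /andP[_ hi] := qs' n.
  apply: (@le_trans _ _ ((6 * (q n)%:~R `^ c^-1) `^ c)).
    by apply: ge0_ler_powR hi; rewrite ?nnegrE ?mulr_ge0 ?powR_ge0// ltW.
  rewrite powRM ?powR_ge0// QcK ler_wpM2r//.
  by rewrite -[leRHS]powRr1// ler_powR//; lra.
Qed.

Theorem theorem1 (R : realType) :
  (forall theta : R, rational theta -> weak_uniform_exponent theta = +oo%E) /\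
  [set weak_uniform_exponent theta | theta in @irrational R] =
    [set x : \bar R | (1%:E <= x <= 2%:E)%E].
Proof.
split=> [theta rat|].
  apply/eqyP => A _; apply: ereal_sup_ubound.
  by exists A => //; exact: weak_admissible_rational.
apply/seteqP; split=> [_ [theta irr <-]|[r| |] /=].
- rewrite /= weak_uniform_exponent_ge1/=.
  apply: ge_ereal_sup => _ [g adm <-]; rewrite lee_fin leNgt.
  by apply/negP => /weak_admissible_gt2 /(_ adm).
- rewrite !lee_fin => /weak_uniform_exponent_surj[theta irr <-].
  by exists theta.
- by rewrite leye_eq andbF.
- by [].
Qed.
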